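(* Let $n\ge2$. Given $m\in\mathbb{N}$, there exist a sufficiently large constant $M>0$ and a non-singular symmetric constant real-valued $(m+1)\times(m+1)$ matrix $(a_{il})$ such that the functions $$\tilde e_i(z):=\sum_{l=0}^m a_{il}\,e_l(z)\,\eta\Big(\frac zM\Big),\qquad i=0,1,\dots,m,$$ satisfy $$\partial_{z_n}\tilde e_i=0\ \text{ on }\partial\mathbb{R}^n_+\qquad\text{and}\qquad(\tilde e_i,e_j)_{L^2_\rho(\mathbb{R}^n_+)}=\delta_{ij}\quad\text{for }i,j=0,1,\dots,m.$$
   Context: $\mathbb{N}=\{0,1,\dots\}$, $\mathbb{R}^n_+=\mathbb{R}^{n-1}\times(0,\infty)$. $\eta$ is a smooth radial cut-off function on $\mathbb{R}^n$ with $\eta(x)=1$ for $|x|\le1$, $\eta(x)=0$ for $|x|\ge2$, $0\le\eta\le1$. The weighted inner product is $(f_1,f_2)_{L^2_\rho(\mathbb{R}_+^n)}=\int_{\mathbb{R}^n_+}f_1f_2\,e^{-|z|^2/4}\,dz$, and $L^2_\rho(\mathbb{R}^n_+)$ is the space of functions with finite associated norm. Let $A_z=\Delta_z-\frac z2\cdot\nabla_z$. For $\alpha\in\mathbb{N}$ let $\tilde H_\alpha(s)=H_\alpha(s/2)$, where $H_\alpha(r)=(-1)^\alpha e^{r^2}\frac{d^\alpha}{dr^\alpha}(e^{-r^2})$ is the Hermite polynomial, and for $\bm\alpha\in\mathbb{N}^n$ let $\tilde{\mathbf H}_{\bm\alpha}(z)=\prod_{i=1}^n\tilde H_{\alpha_i}(z_i)$;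 it satisfies $-A_z\tilde{\mathbf H}_{\bm\alpha}=\frac12(\sum_i\alpha_i)\tilde{\mathbf H}_{\bm\alpha}$. The functions $\tilde{\mathbf H}_{\bm\alpha}$ restricted to $\mathbb{R}^n_+$ with $\alpha_n$ even are the eigenfunctions in $L_\rho^2(\mathbb{R}^n_+)$ of the Neumann problem $-A_zh=\lambda h$ in $\mathbb{R}^n_+$, $-\partial_{z_n}h=0$ on $\partial\mathbb{R}^n_+$. The sequence $(e_i)_{i\ge0}$ is a fixed enumeration of these eigenfunctions ordered by non-decreasing eigenvalue. *)

(* Defs.v *)
From HB Require Import structures.
From mathcomp Require Import all_boot all_order all_algebra.
From mathcomp Require Import all_classical all_reals all_analysis.

Set Implicit Arguments.
Unset Strict Implicit.
Unset Printing Implicit Defensive.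

Import Order.TTheory GRing.Theory Num.Theory.
Import numFieldNormedType.Exports.

Local Open Scope classical_set_scope.
Local Open Scope ring_scope.

Lemma sigma_finite_prod d1 d2 (T1 : measurableType d1) (T2 : measurableType d2)
    (R : realType) (m1 : {sigma_finite_measure set T1 -> \bar R})
    (m2 : {sigma_finite_measure set T2 -> \bar R}) :
  sigma_finite setT (m1 \x m2)%E.
Proof.
have /sigma_finiteP[F [TF ndF Foo]] := sigma_finiteT m1.
have /sigma_finiteP[G [TG ndG Goo]] := sigma_finiteT m2.
exists (fun n => F n `*` G n).
  rewrite -setXTT TF TG predeqE => -[x y]; split.
    move=> [/= [n _ Fnx] [k _ Gky]]; exists (maxn n k) => //; split.
    - by move: x Fnx; exact/subsetPset/ndF/leq_maxl.
    - by move: y Gky; exact/subsetPset/ndG/leq_maxr.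
  by move=> [n _ []/= ? ?]; split; exists n.
move=> k; have [? ?] := Foo k; have [? ?] := Goo k.
split; first exact: measurableX.
by rewrite product_measure1E// lte_mul_pinfty// ge0_fin_numE.
Qed.

(* The library has no Lebesgue measure on [R^n]: it is built on [n]-tuples, which
   carry the product sigma-algebra, as an iterated product measure transported
   along [cons]. *)
Section lebesgue_cons.
Context {R : realType} (n : nat).
Variable mu : {sigma_finite_measure set (n.-tuple (measurableTypeR R)) -> \bar R}.
Local Open Scope ereal_scope.

Definition cons_pair (p : measurableTypeR R * n.-tuple (measurableTypeR R)) :
    n.+1.-tuple (measurableTypeR R) :=
  [the n.+1.-tuple (measurableTypeR R) of p.1 :: p.2].

Lemma measurable_cons_pair : measurable_fun setT cons_pair.
Proof. exact: measurable_cons. Qed.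

Definition lebesgue_cons : set (n.+1.-tuple (measurableTypeR R)) -> \bar R :=
  pushforward (@lebesgue_measure R \x mu) cons_pair.

Let lebesgue_cons0 : lebesgue_cons set0 = 0.
Proof. by rewrite /lebesgue_cons /pushforward preimage_set0 measure0. Qed.

Let lebesgue_cons_ge0 A : 0 <= lebesgue_cons A.
Proof. by rewrite /lebesgue_cons /pushforward. Qed.

Let lebesgue_cons_sigma_additive : semi_sigma_additive lebesgue_cons.
Proof.
move=> F mF tF mUF; rewrite /lebesgue_cons /pushforward preimage_bigcup.
apply: measure_semi_sigma_additive.
- by move=> k; rewrite -[X in measurable X]setTI; exact: measurable_cons_pair.
- apply/trivIsetP => i j _ _ ij; rewrite -preimage_setI.
  by move/trivIsetP : tF => /(_ _ _ _ _ ij) ->//; rewrite preimage_set0.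
- by rewrite -preimage_bigcup -[X in measurable X]setTI; exact: measurable_cons_pair.
Qed.

HB.instance Definition _ := isMeasure.Build _ _ _ lebesgue_cons
  lebesgue_cons0 lebesgue_cons_ge0 lebesgue_cons_sigma_additive.

Let lebesgue_cons_sigma_finite : sigma_finite setT lebesgue_cons.
Proof.
pose m1 : {sigma_finite_measure set _ -> \bar R} := @lebesgue_measure R.
have [F FT Ffin] : sigma_finite setT (m1 \x mu) by exact: sigma_finite_prod.
pose g (t : n.+1.-tuple (measurableTypeR R)) :
    measurableTypeR R * n.-tuple (measurableTypeR R) :=
  (thead t, [tuple of behead t]).
have mg : measurable_fun [set: n.+1.-tuple (measurableTypeR R)] g.
  apply: measurable_fun_pair; last exact: measurable_behead.
  exact: measurable_tnth.
have consK : cancel cons_pair g.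
  by move=> [x t]; congr pair => //; apply: val_inj.
exists (fun k => g @^-1` F k).
  by rewrite -preimage_bigcup -FT preimage_setT.
move=> k; have [mF Foo] := Ffin k; split.
  by rewrite -[X in measurable X]setTI; exact: mg.
rewrite /lebesgue_cons /pushforward -comp_preimage.
by rewrite (_ : g \o cons_pair = id)//; apply/funext => p /=; rewrite consK.
Qed.

HB.instance Definition _ := Measure_isSigmaFinite.Build _ _ _ lebesgue_cons
  lebesgue_cons_sigma_finite.

End lebesgue_cons.

Fixpoint lebesgue_tuple {R : realType} (n : nat) :
    {sigma_finite_measure set (n.-tuple (measurableTypeR R)) -> \bar R} :=
  match n with
  | 0 => [the {sigma_finite_measure set _ -> \bar R} of
           @dirac _ (0.-tuple (measurableTypeR R)) [tuple] R]
  | n'.+1 => [the {sigma_finite_measure set _ -> \bar R} of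
           lebesgue_cons (@lebesgue_tuple R n')]
  end.

(** Boxes have the expected volume, which determines [lebesgue_tuple n]. *)
Lemma lebesgue_tuple_box {R : realType} (n : nat)
    (A : 'I_n -> set (measurableTypeR R)) :
  (forall i, measurable (A i)) ->
  lebesgue_tuple n [set t | forall i, A i (tnth t i)] =
  (\prod_(i < n) lebesgue_measure (A i))%E.
Proof.
elim: n A => [|n IHn] A mA.
  by rewrite big_ord0 /= /dirac indicE mem_set//; case.
have mbox : measurable
    [set t : n.-tuple (measurableTypeR R) | forall i, A (lift ord0 i) (tnth t i)].
  rewrite (_ : [set _ | _] = \bigcap_(i in [set: 'I_n])
      (@tnth _ (measurableTypeR R) ^~ i) @^-1` (A (lift ord0 i))).
    apply: fin_bigcap_measurable => // i _; rewrite -[X in measurable X]setTI.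
    exact: (@measurable_tnth _ (measurableTypeR R) n i).
  by apply/seteqP; split => t /= h i => [_|]; exact: h.
rewrite big_ord_recl -IHn//= /lebesgue_cons /pushforward.
rewrite -product_measure1E//.
congr (_ _); apply/seteqP; split => [[x t]|[x t]] /= h.
  split; first by have := h ord0; rewrite tnth0.
  by move=> i; have := h (lift ord0 i); rewrite tnthS.
case: h => Ax At i; case: (unliftP ord0 i) => [j ->|->].
  by rewrite tnthS; exact: At.
by rewrite tnth0.
Qed.

Notation partial i f := ('D_(delta_mx 0 i) f).

Fixpoint Ck {R : realType} {n : nat} (k : nat) (f : 'rV[R]_n.+1 -> R) : Prop :=
  match k with
  | 0 => continuous f
  | k'.+1 => [/\ continuous f,
      forall i x, derivable f x (delta_mx 0 i) &
      forall i, Ck k' (partial i f)]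
  end.

Definition smooth {R : realType} {n : nat} (f : 'rV[R]_n.+1 -> R) : Prop :=
  forall k, Ck k f.

(* The library norm [`|x|] on ['rV[R]_n] is the sup norm. *)
Definition enorm {R : realType} {n : nat} (x : 'rV[R]_n) : R :=
  Num.sqrt (\sum_(i < n) x 0 i ^+ 2).

Definition radial {R : realType} {n : nat} (f : 'rV[R]_n -> R) : Prop :=
  forall x y, enorm x = enorm y -> f x = f y.

Record is_cutoff {R : realType} {n : nat} (eta : 'rV[R]_n.+1 -> R) : Prop := {
  cutoff_smooth : smooth eta;
  cutoff_radial : radial eta;
  cutoff_ge0 : forall x, 0 <= eta x;
  cutoff_le1 : forall x, eta x <= 1;
  cutoff_eq1 : forall x, enorm x <= 1 -> eta x = 1;
  cutoff_eq0 : forall x, 2 <= enorm x -> eta x = 0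
}.

Definition halfspace {R : realType} {n : nat} : set 'rV[R]_n.+1 :=
  [set z | 0 < z 0 ord_max].

Definition halfspace_boundary {R : realType} {n : nat} : set 'rV[R]_n.+1 :=
  [set z | z 0 ord_max = 0].

Definition row_of_tuple {R : realType} {n : nat} (t : n.-tuple R) : 'rV[R]_n :=
  \row_i tnth t i.

Definition rho {R : realType} {n : nat} (z : 'rV[R]_n) : R :=
  expR (- (enorm z ^+ 2 / 4)).

(* Integrals over subsets of [R^n] are taken in the coordinates of
   [row_of_tuple], since ['rV[R]_n] has no measurable structure. *)
Definition L2rho_inner {R : realType} {n : nat} (f g : 'rV[R]_n.+1 -> R) : R :=
  \int[lebesgue_tuple n.+1]_(t in row_of_tuple @^-1` halfspace)
    (f (row_of_tuple t) * g (row_of_tuple t) * rho (row_of_tuple t)).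

Definition in_L2rho {R : realType} {n : nat} (f : 'rV[R]_n.+1 -> R) : Prop :=
  measurable_fun (row_of_tuple @^-1` halfspace) (f \o row_of_tuple) /\
  (\int[lebesgue_tuple n.+1]_(t in row_of_tuple @^-1` halfspace)
    (f (row_of_tuple t) ^+ 2 * rho (row_of_tuple t))%:E < +oo)%E.

Definition opA {R : realType} {n : nat} (h : 'rV[R]_n.+1 -> R)
    (z : 'rV[R]_n.+1) : R :=
  \sum_(i < n.+1) partial i (partial i h) z
  - \sum_(i < n.+1) z 0 i / 2 * partial i h z.

(* [h] is given on the whole space, so that its derivatives at boundary points
   are the ordinary two-sided ones; this costs nothing for the eigenfunctions,
   which are polynomials. *)
Record neumann_eigenfunction {R : realType} {n : nat} (lambda : R)
    (h : 'rV[R]_n.+1 -> R) : Prop := {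
  eigen_C2 : Ck 2 h;
  eigen_L2 : in_L2rho h;
  eigen_neq0 : exists2 z, halfspace z & h z != 0;
  eigen_eq : forall z, halfspace z -> - opA h z = lambda * h z;
  eigen_neumann : forall z, halfspace_boundary z -> - partial ord_max h z = 0
}.

Definition hermite {R : realType} (k : nat) (r : R) : R :=
  (-1) ^+ k * expR (r ^+ 2) * derive1n k (fun x : R => expR (- x ^+ 2)) r.

Definition hermite_tilde {R : realType} (k : nat) (s : R) : R :=
  hermite k (s / 2).

Definition hermite_multi {R : realType} {n : nat} (alpha : {ffun 'I_n -> nat})
    (z : 'rV[R]_n) : R :=
  \prod_(i < n) hermite_tilde (alpha i) (z 0 i).

Record eigenfunction_enumeration {R : realType} {n : nat}
    (e : nat -> 'rV[R]_n.+1 -> R) : Prop := {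
  enum_inj : injective e;
  enum_range : range e =
    [set hermite_multi alpha |
      alpha in [set alpha : {ffun 'I_n.+1 -> nat} | ~~ odd (alpha ord_max)]];
  enum_sorted : exists2 lambda : nat -> R,
    {homo lambda : i j / (i <= j)%N >-> i <= j} &
    forall i, neumann_eigenfunction (lambda i) (e i)
}.

Definition truncated_combination {R : realType} {n m : nat}
    (eta : 'rV[R]_n.+1 -> R) (e : nat -> 'rV[R]_n.+1 -> R) (M : R)
    (a : 'M[R]_m.+1) (i : 'I_m.+1) (z : 'rV[R]_n.+1) : R :=
  \sum_(l < m.+1) a i l * e l z * eta (M^-1 *: z).

(* Main.v *)
Require Import Defs.
From HB Require Import structures.
From mathcomp Require Import all_boot all_order all_algebra.
From mathcomp Require Import all_classical all_reals all_analysis.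
From mathcomp Require Import measurable_realfun.
From mathcomp Require Import ring lra.

Set Implicit Arguments.
Unset Strict Implicit.
Unset Printing Implicit Defensive.

Import Order.TTheory GRing.Theory Num.Theory.
Import numFieldNormedType.Exports.

Local Open Scope classical_set_scope.
Local Open Scope ring_scope.

(** Writing [G] for the Gram matrix of the [e_l] with weight
    [eta (z / M) * rho z] on the half-space, the dual relations say that the
    coefficient matrix times [G] is the identity, so it must be the inverse of
    the symmetric matrix [G].  If [c G = 0] then [f = \sum_l c_l e_l] satisfies
    [\int eta (z / M) f^2 rho = 0]; as the cut-off is [1] on the ball of radius
    [M], [f] vanishes on a half-ball, and evaluating it on a grid there forces
    [c = 0] because Hermite polynomials of degree less than [N] are independent
    on any [N] points.  Hence [G] is invertible for every [M >= 1].  The Neumann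
    condition passes to the truncations because a radial [eta] is even in the
    normal variable. *)

(** * Hermite polynomials and the independence of their products on grids *)

(** The polynomial factor in the [k]-th derivative of [exp (- x^2)]; the iterated map is the product
    rule with the exponential divided out. *)
Definition gauss_poly {R : realType} (k : nat) : {poly R} :=
  iter k (fun q => q^`() - 2%:P * 'X * q) 1.

Lemma gauss_polyS (R : realType) k :
  gauss_poly k.+1 = (gauss_poly k)^`() - 2%:P * 'X * gauss_poly k :> {poly R}.
Proof. by []. Qed.

(** The term [- 2 X q] raises the degree by one and dominates the derivative of [q]. The exact
    degree makes the passage from monomials triangular. *)
Lemma size_gauss_poly (R : realType) k : size (@gauss_poly R k) = k.+1.
Proof.
elim: k => [|k IHk]; first by rewrite size_poly1.
rewrite gauss_polyS.
have q0 : @gauss_poly R k != 0 by rewrite -size_poly_eq0 IHk.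
have szX : size (- (2%:P * 'X * @gauss_poly R k)) = k.+2.
  rewrite size_polyN -mulrA size_Cmul ?pnatr_eq0//.
  by rewrite mulrC size_mulX// IHk.
rewrite addrC size_polyDl szX// ltnS.
by have := lt_size_deriv q0; rewrite IHk; exact: ltnW.
Qed.

Lemma is_derive_horner (R : realType) (p : {poly R}) (x : R) :
  is_derive x (1 : R) (horner p) p^`().[x].
Proof.
by rewrite derivE derive1E; exact/derivableP/derivable_horner.
Qed.

Lemma derive1n_gauss (R : realType) k :
  derive1n k (fun x : R => expR (- x ^+ 2)) =
  (fun x => (gauss_poly k).[x] * expR (- x ^+ 2)).
Proof.
elim: k => [|k IHk]; first by apply/funext => x /=; rewrite hornerC mul1r.
rewrite /derive1n iterS -/(derive1n k _) IHk; apply/funext => x.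
rewrite derive1E.
have d1 := is_derive_horner (gauss_poly k) x.
have d2 : is_derive x (1 : R) (fun x : R => expR (- x ^+ 2))
    (expR (- x ^+ 2) * (- (x *+ 2))).
  have -> : (fun x : R => expR (- x ^+ 2)) = expR \o horner (- 'X^2).
    by apply/funext => y /=; rewrite hornerN hornerXn.
  have := is_derive_horner (- 'X^2) x.
  rewrite derivN derivXn !hornerE /= -mulr2n => dX.
  have dE := is_derive_expR (- 'X^2).[x].
  by have := is_derive1_comp dE dX; rewrite !hornerE.
have /@derive_val := is_deriveM d1 d2.
rewrite /GRing.scale/= => ->.
rewrite hornerD hornerN !hornerM hornerC hornerX -[x *+ 2]mulr_natl; ring.
Qed.

Lemma hermite_gauss_poly (R : realType) k (r : R) :
  hermite k r = (-1) ^+ k * (gauss_poly k).[r].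
Proof.
rewrite /hermite derive1n_gauss -mulrA; congr (_ * _).
by rewrite mulrCA -expRD subrr expR0 mulr1.
Qed.

(** The Hermite coefficients form a lower triangular matrix with nonzero diagonal, and the monomials
    at the distinct points [x j / 2] form a Vandermonde matrix. *)
Lemma hermite_tilde_unitmx (R : realType) N (x : 'I_N -> R) : injective x ->
  (\matrix_(k < N, j < N) hermite_tilde k (x j)) \in unitmx.
Proof.
move=> x_inj.
pose L : 'M[R]_N := \matrix_(k, j) ((-1) ^+ k * (@gauss_poly R k)`_j).
pose V := Vandermonde N (\row_j (x j / 2)).
have -> : \matrix_(k < N, j < N) hermite_tilde k (x j) = L *m V.
  apply/matrixP => k j; rewrite !mxE /hermite_tilde hermite_gauss_poly.
  rewrite (@horner_coef_wide _ N) ?size_gauss_poly// mulr_sumr.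
  by apply: eq_bigr => i _; rewrite !mxE mulrA.
have Ltrig : is_trig_mx L.
  apply/is_trig_mxP => k j kj; rewrite mxE nth_default ?mulr0//.
  by rewrite size_gauss_poly.
rewrite unitmx_mul; apply/andP; split.
  rewrite unitmxE det_trig// unitfE; apply/prodf_neq0 => k _.
  rewrite mxE mulf_neq0 ?expf_neq0 ?oppr_eq0 ?oner_eq0//.
  have -> : (gauss_poly k)`_k = lead_coef (@gauss_poly R k).
    by rewrite lead_coefE size_gauss_poly.
  by rewrite lead_coef_eq0 -size_poly_eq0 size_gauss_poly.
rewrite unitmxE det_Vandermonde unitfE.
apply/prodf_neq0 => i _; apply/prodf_neq0 => j ij.
rewrite !mxE -mulrBl mulf_neq0 ?invr_eq0 ?pnatr_eq0// subr_eq0.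
by apply: contraTneq ij => /x_inj ->; rewrite ltnn.
Qed.

(* The tensor power of the inverse of the univariate evaluation matrix yields
   functionals dual to the products of one-variable functions. *)
Lemma hermite_multi_free (R : realType) n m
    (alpha : 'I_m -> {ffun 'I_n -> nat}) (c : 'I_m -> R) (x : nat -> R) :
  injective alpha -> injective x ->
  (forall j : 'I_n -> nat,
    \sum_l c l * hermite_multi (alpha l) (\row_i x (j i)) = 0) ->
  forall l, c l = 0.
Proof.
move=> alpha_inj x_inj c0 l0.
(* [N] exceeds every exponent that occurs, so each one indexes a row of [H]. *)
pose N := (\max_l \max_i alpha l i).+1.
have alphaN l i : (alpha l i < N)%N.
  rewrite ltnS; apply: leq_trans (leq_bigmax l).
  exact: (leq_bigmax (F := fun i => alpha l i) i).
pose H : 'M[R]_N := \matrix_(k, j) hermite_tilde k (x j).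
have HU : H \in unitmx.
  by apply: (@hermite_tilde_unitmx _ N (fun j => x j)) => j j' /x_inj/val_inj.
pose B : 'M[R]_N := invmx H.
pose a l i : 'I_N := Ordinal (alphaN l i).
have aB l i : \sum_(j < N) hermite_tilde (alpha l i) (x j) * B j (a l0 i) =
    (a l i == a l0 i)%:R.
  have /matrixP/(_ (a l i) (a l0 i)) := mulmxV HU.
  rewrite !mxE => <-.
  by apply: eq_bigr => j _; rewrite !mxE.
(* The vanishing sums are weighted by products of entries of [B]. Distributivity then turns the sum
   over the grid into a product over coordinates of the Kronecker deltas of [aB], which singles out
   [c l0]. *)
have : \sum_(j : {ffun 'I_n -> 'I_N}) (\prod_i B (j i) (a l0 i)) *
    (\sum_l c l * hermite_multi (alpha l) (\row_i x (j i))) = 0.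
  by rewrite big1// => j _; rewrite c0 mulr0.
under eq_bigr do rewrite mulr_sumr.
rewrite exchange_big/= (bigD1 l0)//= [X in _ + X]big1 ?addr0 => [<-|l ll0].
- under eq_bigr => j _.
    rewrite mulrCA /hermite_multi -big_split/=.
    under eq_bigr do rewrite !mxE mulrC.
    over.
  rewrite -mulr_sumr -(bigA_distr_bigA (fun i (j : 'I_N) =>
    hermite_tilde (alpha l0 i) (x j) * B j (a l0 i))).
  by rewrite big1 ?mulr1// => i _; rewrite aB eqxx.
- under eq_bigr => j _.
    rewrite mulrCA /hermite_multi -big_split/=.
    under eq_bigr do rewrite !mxE mulrC.
    over.
  rewrite -mulr_sumr -(bigA_distr_bigA (fun i (j : 'I_N) =>
    hermite_tilde (alpha l i) (x j) * B j (a l0 i))).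
  apply/eqP; rewrite mulf_eq0; apply/orP; right.
  (* By injectivity [alpha l] and [alpha l0] differ in some coordinate, whose factor is zero. *)
  have [i ii|ex] := pickP (fun i => alpha l i != alpha l0 i).
    by rewrite (bigD1 i)//= aB -val_eqE/= (negbTE ii) mul0r.
  exfalso; move/eqP : ll0; apply; apply/alpha_inj/ffunP => i.
  by apply/eqP; move/negbFE : (ex i).
Qed.

(** * Measurability of coordinates, norm and Gaussian weight *)

Section measurability.
Context {R : realType} {n : nat}.
Local Notation rowT := (@row_of_tuple R n).

Lemma measurable_row_coord (i : 'I_n) :
  measurable_fun [set: n.-tuple (measurableTypeR R)]
    (fun t => rowT t 0 i : measurableTypeR R).
Proof.
rewrite (_ : (fun _ => _) = @tnth _ (measurableTypeR R) ^~ i).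
  exact: measurable_tnth.
by apply/funext => t; rewrite mxE.
Qed.

Lemma measurable_enorm :
  measurable_fun [set: n.-tuple (measurableTypeR R)]
    (fun t => enorm (rowT t) : measurableTypeR R).
Proof.
apply: (@measurableT_comp _ _ _ _ _ _ (@Num.sqrt R)).
  by apply: continuous_measurable_fun; exact: sqrt_continuous.
apply: measurable_sum => i; apply: measurable_funX.
exact: measurable_row_coord.
Qed.

Lemma measurable_rho :
  measurable_fun [set: n.-tuple (measurableTypeR R)]
    (fun t => rho (rowT t) : measurableTypeR R).
Proof.
apply: measurableT_comp; first exact: measurable_expR.
apply: measurableT_comp; first exact: oppr_measurable.
apply: measurable_funM; last exact: measurable_cst.
by apply: measurable_funX; exact: measurable_enorm.
Qed.

End measurability.

(** * Weighted integrals over the half-space *)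

Section halfspace_integrals.
Context {R : realType} {n : nat}.
Local Notation rowT := (@row_of_tuple R n.+1).
Local Notation mu := (lebesgue_tuple n.+1).
Local Notation V := 'rV[R]_n.+1.
Implicit Types f g : V -> R.

Lemma measurable_halfspace :
  measurable (rowT @^-1` halfspace : set (n.+1.-tuple (measurableTypeR R))).
Proof.
have -> : rowT @^-1` halfspace =
    (fun t : n.+1.-tuple (measurableTypeR R) =>
      rowT t 0 ord_max : measurableTypeR R) @^-1` `]0, +oo[%classic.
  by apply/seteqP; split => t; rewrite /halfspace/= in_itv/= andbT.
by rewrite -[X in measurable X]setTI; apply: measurable_row_coord.
Qed.

Lemma rho_gt0 (z : V) : 0 < rho z.
Proof. exact: expR_gt0. Qed.

Lemma integrable_sqr f : in_L2rho f ->
  mu.-integrable (rowT @^-1` halfspace)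
    (fun t => (f (rowT t) ^+ 2 * rho (rowT t))%:E).
Proof.
move=> [mf foo]; apply/integrableP; split.
  apply/measurable_EFinP; apply: measurable_funM.
    by apply: measurable_funX.
  by apply: measurable_funTS; exact: measurable_rho.
apply: le_lt_trans foo; rewrite le_eqVlt; apply/orP; left; apply/eqP.
apply: eq_integral => t _; rewrite gee0_abs// lee_fin.
by rewrite mulr_ge0 ?sqr_ge0// ltW// rho_gt0.
Qed.

(** Domination by [(f^2 + g^2) rho], since [|w| <= 1] and [|f g| <= f^2 + g^2]. *)
Lemma integrable_weighted w f g :
  measurable_fun [set: n.+1.-tuple (measurableTypeR R)]
    (fun t => w (rowT t) : measurableTypeR R) ->
  (forall z, `|w z| <= 1) -> in_L2rho f -> in_L2rho g ->
  mu.-integrable (rowT @^-1` halfspace)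
    (fun t => (w (rowT t) * f (rowT t) * g (rowT t) * rho (rowT t))%:E).
Proof.
move=> mw w1 fL gL.
apply: (le_integrable measurable_halfspace _ _
  (integrableD measurable_halfspace (integrable_sqr fL) (integrable_sqr gL))).
  apply/measurable_EFinP; apply: measurable_funM; last first.
    by apply: measurable_funTS; exact: measurable_rho.
  apply: measurable_funM; last exact: gL.1.
  apply: measurable_funM; last exact: fL.1.
  exact: measurable_funTS.
move=> t _; rewrite lee_fin; set z := rowT t.
rewrite -mulrDl normrM [leRHS]normrM ler_wpM2r//.
rewrite [leRHS]ger0_norm ?addr_ge0 ?sqr_ge0// !normrM.
rewrite -mulrA (le_trans (ler_piMl _ (w1 z))) ?mulr_ge0//.
rewrite -[f z ^+ 2]real_normK ?num_real// -[g z ^+ 2]real_normK ?num_real//.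
have := sqr_ge0 (`|f z| - `|g z|); have := normr_ge0 (f z).
have := normr_ge0 (g z); nra.
Qed.

(* Sup-norm balls are boxes, so nonempty open sets are not negligible. *)
Lemma integral_eq0_open (F : V -> R) (U : set V) :
  measurable_fun (rowT @^-1` halfspace)
    (fun t => F (rowT t) : measurableTypeR R) ->
  (forall z, 0 <= F z) ->
  (\int[mu]_(t in rowT @^-1` halfspace) (F (rowT t))%:E = 0)%E ->
  open U -> U `<=` halfspace -> U !=set0 ->
  exists2 z, U z & F z = 0.
Proof.
move=> mF F0 intF Uopen Uh [z Uz]; apply: contrapT => noz.
have /nbhs_ballP[e/= e0 eU] : nbhs z U by exact: open_nbhs_nbhs.
have mEF := (measurable_EFinP _ _).2 mF.
(* A nonnegative function with zero integral vanishes almost everywhere; [N] is a null set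
   containing the half-space points where [F] is nonzero. *)
have := (ae_eq_integral_abs mu measurable_halfspace mEF).1.
case.
  by rewrite -[RHS]intF; apply: eq_integral => t _; rewrite gee0_abs// lee_fin.
move=> N [mN N0 subN].
(* A box around [z] inside [U]. If [F] had no zero on [U], the box would lie in [N], yet its volume
   is [(2 e)^(n+1) > 0]. *)
pose B : set (n.+1.-tuple (measurableTypeR R)) :=
  [set t | forall i, (ball (z 0 i) e : set (measurableTypeR R)) (tnth t i)].
have BN : B `<=` N.
  move=> t Bt; apply: subN => /= Ft.
  have Ut : U (rowT t).
    by apply: eU; split => // i j; rewrite (ord1 i) mxE; exact: Bt.
  apply: noz; exists (rowT t) => //.
  by have /= := Ft (Uh _ Ut) => -[].
have mB : measurable B.
  rewrite (_ : B = \bigcap_(i in [set: 'I_n.+1])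
      (fun t : n.+1.-tuple (measurableTypeR R) =>
        rowT t 0 i : measurableTypeR R) @^-1` ball (z 0 i) e).
    apply: fin_bigcap_measurable => // i _; rewrite -[X in measurable X]setTI.
    by apply: measurable_row_coord => //; exact: measurable_ball.
  apply/seteqP; split => t /= h i => [_|]; first by rewrite /= mxE; exact: h.
  by have := h i Logic.I; rewrite /= mxE.
have : (mu B <= mu N)%E by apply: le_measure; rewrite ?inE.
have -> : mu B = (\prod_(i < n.+1) lebesgue_measure (ball (z 0%R i) e))%E.
  by apply: lebesgue_tuple_box => i; exact: measurable_ball.
rewrite N0.
under eq_bigr do rewrite lebesgue_measure_ball ?(ltW e0)//.
rewrite prodEFin lee_fin leNgt => /negP; apply.
by apply: prodr_gt0 => i _; rewrite mulrn_wgt0.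
Qed.

End halfspace_integrals.

(** * Directional derivatives and the Euclidean norm *)

(** Restricting to a line makes the one-variable chain rule available. *)
Lemma is_derive_line (R : numFieldType) (V W : normedModType R) (f : V -> W)
    (x v : V) (df : W) :
  is_derive x v f df <-> is_derive (0 : R) 1 (fun h : R => f (h *: v + x)) df.
Proof.
have E : 'D_v f x = 'D_1 (fun h : R => f (h *: v + x)) 0.
  rewrite /derive; set g1 := fun h => h^-1 *: _; set g2 := fun h => h^-1 *: _.
  suff -> : g1 = g2 by [].
  by apply/funext => h; rewrite /g1 /g2/= addr0 scale0r add0r [_%:A]mulr1.
split=> -[dfx <-]; apply: DeriveDef.
- exact: (derivable1P f x v).1.
- exact/esym/E.
- exact: (derivable1P f x v).2.
- exact/E.
Qed.

(** Differentiating [g (- h) = g h] at [0] shows that the derivative there equals its own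
    opposite. *)
Lemma is_derive_even (R : realType) (g : R -> R) :
  derivable g 0 1 -> (forall h, g (- h) = g h) -> is_derive (0 : R) 1 g 0.
Proof.
move=> dg g_even; have dg0 := derivableP dg.
have dgN : is_derive (- 0 : R) 1 g ('D_1 g 0) by rewrite oppr0.
have dN := is_deriveN (is_derive_id (0 : R) 1).
have := is_derive1_comp dgN dN; rewrite (_ : g \o _ = g); last exact/funext.
move=> /@derive_val; rewrite mulrN1 => eq_opp.
have D0 : 'D_1 g 0 = 0 :> R.
  by apply/eqP; have /eqP := eq_opp; rewrite -addr_eq0 -mulr2n mulrn_eq0.
by apply: DeriveDef.
Qed.

Section euclidean_norm.
Context {R : realType} {n : nat}.
Implicit Types z : 'rV[R]_n.

Lemma enormZ c z : enorm (c *: z) = `|c| * enorm z.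
Proof.
rewrite /enorm -sqrtr_sqr -sqrtrM ?sqr_ge0// mulr_sumr.
by congr Num.sqrt; apply: eq_bigr => i _; rewrite mxE exprMn.
Qed.

Lemma enorm_ge0 z : 0 <= enorm z. Proof. exact: sqrtr_ge0. Qed.

Lemma enorm_delta (i : 'I_n) : enorm (delta_mx 0 i : 'rV[R]_n) = 1.
Proof.
rewrite /enorm (bigD1 i)//= big1 => [|j ji].
  by rewrite mxE !eqxx expr1n addr0 sqrtr1.
by rewrite mxE (negbTE ji) andbF expr0n.
Qed.

Lemma continuous_enorm : continuous (@enorm R n).
Proof.
move=> z; apply: continuous_comp; last exact: sqrt_continuous.
apply: (continuous_big (op := +%R)) => [|i _]; first exact: add_continuous.
move=> y; apply: (@continuous_comp _ _ _ (fun z => z 0 i) (fun x => x ^+ 2)).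
  exact: coord_continuous.
exact: exprn_continuous.
Qed.

Lemma enorm_reflect (i : 'I_n) z h : z 0 i = 0 ->
  enorm (- h *: delta_mx 0 i + z) = enorm (h *: delta_mx 0 i + z).
Proof.
move=> zi0; rewrite /enorm; congr Num.sqrt; apply: eq_bigr => j _.
rewrite !mxE eqxx/=; case: eqVneq => [->|_]; last by rewrite !mulr0.
by rewrite zi0 !mulr1 !addr0 sqrrN.
Qed.

End euclidean_norm.

Lemma Rintegral_lincomb d (T : measurableType d) (R : realType)
    (mu : {measure set T -> \bar R}) (D : set T) (I : finType) (c : I -> R)
    (F : I -> T -> R) : measurable D ->
  (forall i, mu.-integrable D (EFin \o F i)) ->
  \int[mu]_(t in D) (\sum_i c i * F i t) = \sum_i c i * \int[mu]_(t in D) F i t.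
Proof.
move=> mD intF; rewrite /Rintegral.
have intcF i : mu.-integrable D (fun t => (c i * F i t)%:E).
  by have := integrableZl mD (c i) (intF i).
under eq_integral => t _ do rewrite -sumEFin.
rewrite integral_sum// -sum_fine => [|i _]; last exact: integrable_fin_num.
by apply: eq_bigr => i _; exact: RintegralZl.
Qed.

(** * The rescaled cut-off *)

Section cutoff.
Context {R : realType} {n : nat} (eta : 'rV[R]_n.+1 -> R).
Hypothesis heta : is_cutoff eta.

Lemma cutoff_abs_le1 z : `|eta z| <= 1.
Proof. by rewrite ger0_norm ?(cutoff_ge0 heta)// (cutoff_le1 heta). Qed.

(* A radial function is a continuous function of the measurable [enorm]. *)
Lemma measurable_cutoff_scale (c : R) :
  measurable_fun [set: n.+1.-tuple (measurableTypeR R)]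
    (fun t => eta (c *: row_of_tuple t) : measurableTypeR R).
Proof.
(* By radiality [eta] is determined by its values on the line spanned by a unit vector. *)
pose d : 'rV[R]_n.+1 := delta_mx 0 0.
pose g (r : R) := eta (r *: d).
have -> : (fun t : n.+1.-tuple (measurableTypeR R) => eta (c *: row_of_tuple t)) =
    g \o (fun t => c * enorm (row_of_tuple t)).
  apply/funext => t /=; apply: (cutoff_radial heta).
  by rewrite !enormZ enorm_delta mulr1 normrM (ger0_norm (enorm_ge0 _)).
apply: measurableT_comp.
  apply: continuous_measurable_fun => r.
  apply: continuous_comp; first exact: scalel_continuous.
  exact: (cutoff_smooth heta 0).
by apply: measurable_funM => //; exact: measurable_enorm.
Qed.

(* Being radial, [eta] is even across the boundary hyperplane. *)
Lemma cutoff_scale_neumann (c : R) (z : 'rV[R]_n.+1) : halfspace_boundary z ->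
  is_derive z (delta_mx 0 ord_max) (fun z => eta (c *: z)) 0.
Proof.
move=> z0; apply/is_derive_line; apply: is_derive_even; last first.
  by move=> h; apply: (cutoff_radial heta); rewrite !enormZ enorm_reflect.
pose d : 'rV[R]_n.+1 := delta_mx 0 ord_max.
have [_ /(_ ord_max (c *: z)) deta _] := cutoff_smooth heta 1.
have /is_derive_line d1 := derivableP deta.
have d2 : is_derive (0 : R) 1 (c \*: id) (c *: 1).
  exact: is_deriveZ.
(* The base point [0] is rewritten as [c * 0], the form in which the chain rule expects it. *)
have d1c : is_derive ((c \*: (@id R)) 0) 1
    (fun h : R => eta (h *: d + c *: z)) ('D_d eta (c *: z)).
  by rewrite /= scaler0.
have := is_derive1_comp d1c d2.
move=> /@ex_derive; rewrite (_ : _ \o _ = fun h => eta (c *: (h *: d + z)))//.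
by apply/funext => h /=; rewrite scalerDr scalerA.
Qed.

End cutoff.

(** * The Gram matrix with truncated weight *)

Section truncation.
Context {R : realType} {n : nat} (eta : 'rV[R]_n.+1 -> R).
Hypothesis heta : is_cutoff eta.
Variables (M : R) (m : nat) (e : 'I_m -> 'rV[R]_n.+1 -> R).
Hypothesis eL2 : forall l, in_L2rho (e l).

Local Notation rowT := (@row_of_tuple R n.+1).
Local Notation mu := (lebesgue_tuple n.+1).
Local Notation half := (rowT @^-1` halfspace).

Definition truncated_gram : 'M[R]_m :=
  \matrix_(l, j) L2rho_inner (fun z => e l z * eta (M^-1 *: z)) (e j).

Lemma truncated_gram_sym : truncated_gram^T = truncated_gram.
Proof.
apply/matrixP => i j; rewrite !mxE; apply: eq_Rintegral => t _ /=; ring.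
Qed.

Lemma integrable_truncated_gram l j :
  mu.-integrable half (fun t => (e l (rowT t) * eta (M^-1 *: rowT t) *
    e j (rowT t) * rho (rowT t))%:E).
Proof.
have := integrable_weighted (w := fun z => eta (M^-1 *: z))
  (measurable_cutoff_scale heta M^-1)
  (fun z => cutoff_abs_le1 heta _) (eL2 l) (eL2 j).
by under eq_fun do rewrite [eta _ * _]mulrC.
Qed.

(** When [c] is a row of the inverse Gram matrix, the right-hand side is a Kronecker delta. *)
Lemma truncated_gram_lincomb (c : 'I_m -> R) j :
  L2rho_inner (fun z => \sum_l c l * e l z * eta (M^-1 *: z)) (e j) =
  \sum_l c l * truncated_gram l j.
Proof.
transitivity (\sum_l c l * \int[mu]_(t in half) (e l (rowT t) *
    eta (M^-1 *: rowT t) * e j (rowT t) * rho (rowT t))); last first.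
  by apply: eq_bigr => l _; rewrite mxE.
rewrite -Rintegral_lincomb => [|| l].
- apply: eq_Rintegral => t _; rewrite !mulr_suml.
  by apply: eq_bigr => l _; rewrite !mulrA.
- exact: measurable_halfspace.
- exact: integrable_truncated_gram.
Qed.

(** Pairing [c G = 0] with [c] makes a nonnegative integrand have zero integral. If the continuous
    combination were nonzero at some [z], the integrand would be positive on an open part of the
    unit half-ball, where [1 <= M] makes the cut-off equal to [1]. *)
Lemma truncated_gram_kernel (c : 'rV[R]_m) : c *m truncated_gram = 0 ->
  1 <= M -> (forall l, continuous (e l)) ->
  forall z, halfspace z -> enorm z < 1 -> \sum_l c 0 l * e l z = 0.
Proof.
move=> cG0 M1 ec z0 z0h z01; pose f z := \sum_l c 0 l * e l z.
have M0 : 0 < M := lt_le_trans ltr01 M1.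
pose F z := eta (M^-1 *: z) * f z ^+ 2 * rho z.
have FE t : F (rowT t) = \sum_(p : 'I_m * 'I_m) (c 0 p.1 * c 0 p.2) *
    (e p.1 (rowT t) * eta (M^-1 *: rowT t) * e p.2 (rowT t) * rho (rowT t)).
  rewrite /F /f expr2 mulr_suml mulr_sumr mulr_suml.
  rewrite -(pair_bigA _ (fun l j => c 0 l * c 0 j *
    (e l (rowT t) * eta (M^-1 *: rowT t) * e j (rowT t) * rho (rowT t))))/=.
  apply: eq_bigr => l _; rewrite mulr_sumr mulr_sumr mulr_suml.
  by apply: eq_bigr => j _; ring.
have intF : mu.-integrable half (fun t => (F (rowT t))%:E).
  under eq_fun do rewrite FE -sumEFin.
  apply: integrable_sum => [|p _]; first exact: measurable_halfspace.
  have := integrableZl measurable_halfspace (c 0 p.1 * c 0 p.2)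
    (integrable_truncated_gram p.1 p.2).
  exact.
have F0 : (\int[mu]_(t in half) (F (rowT t))%:E = 0)%E.
  rewrite -[LHS]fineK; last exact: (integrable_fin_num measurable_halfspace).
  congr EFin; transitivity (\int[mu]_(t in half) F (rowT t)); first by [].
  under eq_Rintegral => t _ do rewrite FE.
  rewrite Rintegral_lincomb => [|| p].
  (* Regrouped, the double sum is [c G c^T]. *)
  - transitivity (\sum_j (\sum_l c 0 l * truncated_gram l j) * c 0 j).
      rewrite (eq_bigr (fun j => \sum_l c 0 l * c 0 j * truncated_gram l j)).
        rewrite exchange_big pair_bigA/=; apply: eq_bigr => p _.
        by rewrite mxE.
      by move=> j _; rewrite mulr_suml; apply: eq_bigr => l _; ring.
    apply: big1 => j _; have /matrixP/(_ 0 j) := cG0.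
    by rewrite !mxE => ->; rewrite mul0r.
  - exact: measurable_halfspace.
  - exact: integrable_truncated_gram.
apply: contrapT => /eqP fz0.
have fc : continuous f.
  apply: (continuous_big (op := +%R)) => [|l _]; first exact: add_continuous.
  move=> z; apply: (@continuous_comp _ _ _ (e l) ( *%R (c 0 l))); first exact: ec.
  exact: mulrl_continuous.
pose U : set 'rV[R]_n.+1 := halfspace `&` [set z | enorm z < 1] `&`
  [set z | f z != 0].
have Uopen : open U.
  apply: openI; first apply: openI.
  - apply: (@open_comp _ _ (fun z : 'rV[R]_n.+1 => z 0 ord_max) [set x | 0 < x]).
      by move=> z _; exact: coord_continuous.
    exact: open_gt.
  - apply: (@open_comp _ _ (@enorm R n.+1) [set x | x < 1]).
      by move=> z _; exact: continuous_enorm.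
    exact: open_lt.
  - apply: (@open_comp _ _ f [set x | x != 0]).
      by move=> z _; exact: fc.
    exact: open_neq.
have [||||z [[zh /= z1] /= fz]] := integral_eq0_open (F := F) _ _ F0 Uopen.
- by apply/measurable_EFinP; case/integrableP : intF.
- move=> z; apply: mulr_ge0; last exact/ltW/rho_gt0.
  by apply: mulr_ge0; [exact: cutoff_ge0|exact: sqr_ge0].
- by move=> z [[]].
- by exists z0; split.
rewrite /F (cutoff_eq1 heta) ?mul1r.
  apply/eqP; rewrite mulf_neq0 ?expf_neq0//.
  by rewrite gt_eqF// rho_gt0.
rewrite enormZ gtr0_norm ?invr_gt0// mulrC ler_pdivrMr// mul1r.
exact: le_trans (ltW z1) M1.
Qed.

End truncation.

Theorem corollary2p5 (R : realType) (n : nat) (hn : (2 <= n.+1)%N)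
    (eta : 'rV[R]_n.+1 -> R) (heta : is_cutoff eta)
    (e : nat -> 'rV[R]_n.+1 -> R) (he : eigenfunction_enumeration e)
    (m : nat) :
  exists2 M0 : R, 0 < M0 &
    forall M : R, M0 <= M ->
      exists a : 'M[R]_m.+1,
        [/\ a \in unitmx,
            a^T = a,
            forall (i : 'I_m.+1) (z : 'rV[R]_n.+1), halfspace_boundary z ->
              is_derive z (delta_mx 0 ord_max)
                (truncated_combination eta e M a i) 0 &
            forall i j : 'I_m.+1,
              L2rho_inner (truncated_combination eta e M a i) (e j)
              = (i == j)%:R].
Proof.
have [lambda _ eigen] := enum_sorted he.
have /choice[alpha eE] l : exists alpha, e l = hermite_multi alpha.
  have : range e (e l) by exists l.
  by rewrite (enum_range he) => -[alpha _ <-]; exists alpha.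
have alpha_inj : injective (fun l : 'I_m.+1 => alpha l).
  move=> l j alj; apply/val_inj/(enum_inj he).
  by rewrite !eE; congr hermite_multi.
(* The threshold [1] suffices: for [M >= 1] the cut-off is [1] on the unit ball, which contains the
   grid chosen below. *)
exists 1 => // M M1.
pose G := truncated_gram eta M (fun l : 'I_m.+1 => e l).
have eL2 (l : 'I_m.+1) : in_L2rho (e l) by exact: eigen_L2 (eigen l).
have econt (l : 'I_m.+1) : continuous (e l) by have [] := eigen_C2 (eigen l).
have GU : G \in unitmx.
  (* A singular [G] would have a nonzero row [c] in its left kernel. *)
  rewrite unitmxE unitfE; apply/negP => /det0P[c c0 cG0].
  move/eqP : c0; apply; apply/rowP => l; rewrite [RHS]mxE.
  (* Distinct positive values with [x k ^ 2 <= x k <= 1 / (n + 2)]: a grid point has [n + 1]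
     coordinates, so its squared norm is at most [(n + 1) / (n + 2) < 1]. *)
  pose x k : R := (n.+2 + k)%:R^-1.
  have x0 k : 0 < x k by rewrite invr_gt0 ltr0n.
  have x_inj : injective x.
    by move=> k k' /invr_inj/eqP; rewrite eqr_nat eqn_add2l => /eqP.
  move: l; apply: (hermite_multi_free alpha_inj x_inj) => j.
  under eq_bigr do rewrite -eE.
  apply: (truncated_gram_kernel heta eL2 cG0 M1 econt).
    by rewrite /halfspace/= mxE.
  rewrite /enorm -sqrtr1 ltr_sqrt//.
  apply: (@le_lt_trans _ _ (\sum_(i < n.+1) n.+2%:R^-1)).
    apply: ler_sum => i _; rewrite mxE.
    have xn : x (j i) <= n.+2%:R^-1.
      by rewrite lef_pV2 ?posrE ?ltr0n// ler_nat leq_addr.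
    apply: le_trans xn; rewrite expr2 ler_piMl ?(ltW (x0 _))//.
    by rewrite invf_le1 ?ltr0n// ler1n.
  rewrite sumr_const card_ord -[ltLHS]mulr_natl ltr_pdivrMr ?ltr0n// mul1r.
  by rewrite ltr_nat.
exists (invmx G); split.
- by rewrite unitmx_inv.
- by rewrite trmx_inv truncated_gram_sym.
- move=> i z z0.
  (* In the product rule both terms vanish, as [e l] and the rescaled cut-off each have zero normal
     derivative on the boundary. *)
  have de (l : 'I_m.+1) : is_derive z (delta_mx 0 ord_max)
      (fun z => invmx G i l * e l z * eta (M^-1 *: z)) 0.
    have del : is_derive z (delta_mx 0 ord_max) (e l) 0.
      have [_ /(_ ord_max z) del _] := eigen_C2 (eigen l).
      apply: DeriveDef => //; apply/eqP.
      by rewrite -oppr_eq0 (eigen_neumann (eigen l) z0).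
    have := is_deriveM (is_deriveZ (invmx G i l) del)
      (cutoff_scale_neumann heta M^-1 z0).
    by rewrite !scaler0 addr0.
  have := is_derive_sum de; rewrite fct_sumE sumr_const mul0rn.
  exact.
- move=> i j; have := truncated_gram_lincomb heta M eL2 (invmx G i) j.
  rewrite /truncated_combination => ->.
  by have /matrixP/(_ i j) := mulVmx GU; rewrite !mxE.
Qed.
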